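(* Let $p(X_1,\dots,X_n)=\sum_{i=1}^n a_iX_i+a_0$ be a premonic linear pattern (homogeneous or not) admitted by an ideal $I$ of a numerical semigroup $S$. Then the image $p(I)$ is an ideal of $S$.
   Context: $\mathbb{Z}_+$ denotes the set of non-negative integers. A numerical semigroup is a subset of $\mathbb{Z}_+$ that contains $0$, is closed under addition and has finite complement in $\mathbb{Z}_+$. An ideal of a numerical semigroup $S$ is a nonempty subset $I\subseteq S$ with $I+S\subseteq I$. Linear patterns are polynomials $\sum_{i=1}^n a_iX_i+a_0$ with integer coefficients; such a pattern $p$ is admitted by an ideal $I$ of $S$ if $p(s_1,\dots,s_n)\in S$ for every non-increasing sequence $s_1\ge\cdots\ge s_n$ of elements of $I$. It is premonic if $\sum_{i=1}^{n'}a_i=1$ for some $1\le n'\leq n$. The image is $p(I)=\{p(s_1,\dots,s_n): s_1\ge\cdots\ge s_n,\ s_i\in I\}$. *)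

(* Defs.v *)
From HB Require Import structures.
From mathcomp Require Import all_boot all_order all_algebra.
From mathcomp Require Import classical_sets cardinality.
From mathcomp Require Import mpoly.

Set Implicit Arguments.
Unset Strict Implicit.
Unset Printing Implicit Defensive.

Import Order.TTheory GRing.Theory Num.Theory.
Local Open Scope classical_set_scope.
Local Open Scope ring_scope.

(* Semigroups, ideals and images of patterns all live in [set int], so that
   the possibly negative values of a pattern need no truncation. *)
Definition Zplus : set int := [set z | 0 <= z].

Record numerical_semigroup (S : set int) : Prop := NumericalSemigroup {
  ns_sub : S `<=` Zplus;
  ns_zero : S 0;
  ns_add : forall x y, S x -> S y -> S (x + y);
  ns_cofinite : finite_set (Zplus `\` S)
}.

Record ideal_of (S I : set int) : Prop := IdealOf {
  id_nonempty : I !=set0;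
  id_sub : I `<=` S;
  id_add : forall x s, I x -> S s -> I (x + s)
}.

(* The coefficients a_1, ..., a_n are indexed by 'I_n, i.e. shifted to
   0, ..., n-1. *)
Definition linear_pattern (n : nat) (a : 'I_n -> int) (a0 : int) :
  {mpoly int[n]} := \sum_(i < n) a i *: 'X_i + a0%:MP.

Definition noninc_seq_in (I : set int) (n : nat) (s : 'I_n -> int) : Prop :=
  (forall i, I (s i)) /\ (forall i j : 'I_n, (i <= j)%N -> s j <= s i).

Definition admits (S I : set int) (n : nat) (p : {mpoly int[n]}) : Prop :=
  forall s : 'I_n -> int, noninc_seq_in I s -> S p.@[s].

Definition premonic (n : nat) (a : 'I_n -> int) : Prop :=
  exists2 n' : nat, (1 <= n' <= n)%N & \sum_(i < n | (i < n')%N) a i = 1.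

Definition pattern_image (n : nat) (p : {mpoly int[n]}) (I : set int) :
  set int := [set p.@[s] | s in [set s | noninc_seq_in I s]].

(* Main.v *)
Require Import Defs.
From mathcomp Require Import all_boot all_order all_algebra.
From mathcomp Require Import classical_sets.
From mathcomp Require Import mpoly.

Import Order.TTheory GRing.Theory Num.Theory.

(** The image is stable under adding [t] in [S] because such a translation of
    the value can be performed on the arguments: premonicity gives an initial
    segment of variables whose coefficients sum to 1, so raising exactly those
    arguments by [t] raises the value of the pattern by [t]
    ([meval_shift_prefix]). The raised arguments remain in the ideal by
    stability under [S], and remain non-increasing because [t] is non-negative
    and the segment is initial ([noninc_shift_prefix]). The image lies in [S]
    by admissibility and is nonempty since a constant sequence is
    non-increasing. *)

Lemma meval_linear_pattern (n : nat) (a : 'I_n -> int) (a0 : int)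
    (s : 'I_n -> int) :
  meval s (linear_pattern a a0) = (\sum_(i < n) a i * s i + a0)%R.
Proof.
rewrite /linear_pattern mevalD mevalC raddf_sum /=.
by congr (_ + _)%R; apply: eq_bigr => i _; rewrite mevalZ mevalXU.
Qed.

Definition shift_prefix (n k : nat) (t : int) (s : 'I_n -> int) : 'I_n -> int :=
  fun i => (s i + (if (i < k)%N then t else 0))%R.

Lemma meval_shift_prefix (n : nat) (a : 'I_n -> int) (a0 t : int) (k : nat)
    (s : 'I_n -> int) :
  (\sum_(i < n | (i < k)%N) a i = 1)%R ->
  meval (shift_prefix n k t s) (linear_pattern a a0) =
  (meval s (linear_pattern a a0) + t)%R.
Proof.
move=> sum1; rewrite !meval_linear_pattern /shift_prefix.
under eq_bigr => i _ do rewrite mulrDr.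
rewrite big_split /= addrAC; congr (_ + _ + _)%R.
rewrite -[RHS]mul1r -sum1 mulr_suml [RHS]big_mkcond.
by apply: eq_bigr => i _; case: ifP => _ //; rewrite mulr0.
Qed.

Lemma noninc_shift_prefix (S I : set int) (n k : nat) (t : int)
    (s : 'I_n -> int) :
  ideal_of S I -> S t -> (0 <= t)%R ->
  noninc_seq_in I s -> noninc_seq_in I (shift_prefix n k t s).
Proof.
move=> idI St t_ge0 [Is s_noninc]; rewrite /shift_prefix; split=> [i | i j le_ij].
  by case: ifP => _; [apply: (id_add idI) | rewrite addr0].
apply: lerD; first exact: s_noninc.
(* The prefix is downward closed: if [j] is raised, then so is [i]. *)
case: (ltnP j k) => [lt_jk | _]; first by rewrite (leq_ltn_trans le_ij lt_jk).
by case: ifP.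
Qed.

Theorem lemma6 (S I : set int) (n : nat) (a : 'I_n -> int) (a0 : int) :
  numerical_semigroup S ->
  ideal_of S I ->
  premonic a ->
  admits S I (linear_pattern a a0) ->
  ideal_of S (pattern_image (linear_pattern a a0) I).
Proof.
move=> nsS idI [k _ sum1] adm; split.
- have [x Ix] := id_nonempty idI.
  by exists (meval (fun=> x) (linear_pattern a a0)), (fun=> x).
- by move=> _ [s Hs <-]; apply: adm.
- move=> _ t [s Hs <-] St; exists (shift_prefix n k t s).
    by exact: noninc_shift_prefix idI St (ns_sub nsS St) Hs.
  exact: meval_shift_prefix.
Qed.
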